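(* Let $x_1,\dots,x_n$ be real numbers with minimum $a$, maximum $b$, arithmetic mean $\overline x$ and variance $s^2$, forming a leptokurtic or mesokurtic distribution. Then $$s^2\le(b-a)\sqrt{\frac{(\overline x-a)(b-\overline x)}{6}}\le\frac{(b-a)^2}{2\sqrt6}.$$
   Context: For real numbers $x_1,\dots,x_n$: $a=\min_i x_i$, $b=\max_i x_i$, $\overline x=\frac1n\sum_{i=1}^n x_i$, $m_2=s^2=\frac1n\sum_{i=1}^n(x_i-\overline x)^2$ and $m_4=\frac1n\sum_{i=1}^n(x_i-\overline x)^4$. The distribution is leptokurtic or mesokurtic if $m_2>0$ and $\frac{m_4}{m_2^2}\ge3$. *)

(* Defs.v *)
From HB Require Import structures.
From mathcomp Require Import all_boot all_order all_algebra.
Set Implicit Arguments.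
Unset Strict Implicit.
Unset Printing Implicit Defensive.
Import Order.TTheory GRing.Theory Num.Theory.
Local Open Scope ring_scope.

(* A nonempty sample x_1, ..., x_N is a function on 'I_N with N = n.+1.       *)

(* The base point x ord0 of the big operators is itself one of the values, so
   it does not affect the minimum or the maximum. *)
Definition sample_min (R : rcfType) (n : nat) (x : 'I_n.+1 -> R) : R :=
  \big[Num.min/x ord0]_(i < n.+1) x i.

Definition sample_max (R : rcfType) (n : nat) (x : 'I_n.+1 -> R) : R :=
  \big[Num.max/x ord0]_(i < n.+1) x i.

Definition mean (R : rcfType) (n : nat) (x : 'I_n.+1 -> R) : R :=
  (\sum_(i < n.+1) x i) / n.+1%:R.

(* The divisor is the sample size, not the sample size minus one. *)
Definition central_moment (R : rcfType) (n : nat) (k : nat)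
    (x : 'I_n.+1 -> R) : R :=
  (\sum_(i < n.+1) (x i - mean x) ^+ k) / n.+1%:R.

Definition variance (R : rcfType) (n : nat) (x : 'I_n.+1 -> R) : R :=
  central_moment 2 x.

Definition lepto_or_mesokurtic (R : rcfType) (n : nat)
    (x : 'I_n.+1 -> R) : Prop :=
  0 < central_moment 2 x /\
  3%:R <= central_moment 4 x / central_moment 2 x ^+ 2.

(* Main.v *)
Require Import Defs.
From HB Require Import structures.
From mathcomp Require Import all_boot all_order all_algebra.
From mathcomp Require Import ring lra.
Import Order.TTheory GRing.Theory Num.Theory.
Local Open Scope ring_scope.

(** Write [p = mean x - a], [q = b - mean x] and [y i = x i - mean x], so that
    the deviations [y i] lie in [[-p, q]] and average to [0]. The heart of the
    matter is the kurtosis-free inequality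
      [m4 + 3 * m2 ^ 2 <= p * q * (b - a) ^ 2],
    an equality for samples that take only the values [a] and [b]
    ([central_moment4_le]). It follows from convexity. First, [m2 <= p * q]
    ([variance_le], the Bhatia-Davis inequality) turns [3 * m2 ^ 2] into the
    linear term [3 * p * q * m2]. Then the convex function
    [t ^ 4 + 3 * p * q * t ^ 2] lies below its chord on [[-p, q]], and the
    average of the chord over the centred sample is its value at [0], namely
    [p * q * (p + q) ^ 2].

    When [m4 >= 3 * m2 ^ 2], the left-hand side is at least [6 * m2 ^ 2], and
    taking square roots gives the first bound. The second is
    [p * q <= ((p + q) / 2) ^ 2]. *)

Lemma mean_ge0 (R : rcfType) (n : nat) (f : 'I_n.+1 -> R) :
  (forall i, 0 <= f i) -> 0 <= mean f.
Proof. by move=> f_ge0; rewrite divr_ge0 ?ler0n ?sumr_ge0. Qed.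

Lemma sum_deviation (R : rcfType) (n : nat) (x : 'I_n.+1 -> R) :
  \sum_(i < n.+1) (x i - mean x) = 0.
Proof.
rewrite big_split /= sumr_const card_ord -mulr_natr mulNr.
by rewrite divfK ?subrr // pnatr_eq0.
Qed.

(** The linear coefficient disappears because the deviations average to [0]. *)
Lemma mean_quartic (R : rcfType) (n : nat) (x : 'I_n.+1 -> R)
    (c0 c1 c2 c4 : R) :
  mean (fun i => c0 + c1 * (x i - mean x) + c2 * (x i - mean x) ^+ 2
                 + c4 * (x i - mean x) ^+ 4)
  = c0 + c2 * central_moment 2 x + c4 * central_moment 4 x.
Proof.
rewrite {1}/mean !big_split /= -!mulr_sumr sum_deviation mulr0 addr0.
rewrite sumr_const card_ord -[c0 *+ _]mulr_natr !mulrDl -!mulrA.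
by rewrite mulfV ?mulr1 // pnatr_eq0.
Qed.

Lemma sample_min_le (R : rcfType) (n : nat) (x : 'I_n.+1 -> R) i :
  sample_min x <= x i.
Proof. exact: bigmin_le_cond. Qed.

Lemma sample_max_ge (R : rcfType) (n : nat) (x : 'I_n.+1 -> R) i :
  x i <= sample_max x.
Proof. exact: le_bigmax_cond. Qed.

(** Average [(x i - a) * (b - x i) >= 0]. *)
Lemma variance_le (R : rcfType) (n : nat) (x : 'I_n.+1 -> R) (a b : R) :
  (forall i, a <= x i <= b) ->
  central_moment 2 x <= (mean x - a) * (b - mean x).
Proof.
move=> xab.
set p := mean x - a; set q := b - mean x.
have : 0 <= p * q + -1 * central_moment 2 x + 0 * central_moment 4 x.
  rewrite -(mean_quartic _ _ x _ (q - p)); apply: mean_ge0 => i.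
  have /andP[ax xb] := xab i.
  rewrite [leRHS](_ : _ = (x i - a) * (b - x i)); last by rewrite /p /q; ring.
  by rewrite mulr_ge0 ?subr_ge0.
by rewrite mul0r addr0 mulN1r subr_ge0.
Qed.

(** With [y], [p], [q] the deviation and the two gaps, the chord of
    [t ^ 4 + 3 * p * q * t ^ 2] exceeds it at [y] by the product of
    [(y + p) * (q - y)] and the nonnegative quadratic
    [y ^ 2 + (q - p) * y + (p + q) ^ 2]. *)
Lemma central_moment4_le (R : rcfType) (n : nat) (x : 'I_n.+1 -> R) (a b : R) :
  (forall i, a <= x i <= b) ->
  central_moment 4 x + 3%:R * central_moment 2 x ^+ 2
    <= (mean x - a) * (b - mean x) * (b - a) ^+ 2.
Proof.
move=> xab; have m2_le := variance_le _ _ _ _ _ xab.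
have m2_ge0 : 0 <= central_moment 2 x by apply: mean_ge0 => i; apply: sqr_ge0.
set m2 := central_moment 2 x in m2_le m2_ge0 *.
set p := mean x - a in m2_le *; set q := b - mean x in m2_le *.
have chord : 0 <= p * q * (b - a) ^+ 2 + - (3%:R * (p * q)) * m2
                  + -1 * central_moment 4 x.
  rewrite -(mean_quartic _ _ x _ ((q - p) * ((b - a) ^+ 2 + p * q))).
  apply: mean_ge0 => i; have /andP[ax xb] := xab i.
  set y := x i - mean x.
  rewrite [leRHS](_ : _ = (x i - a) * (b - x i)
                       * (y ^+ 2 + (q - p) * y + (b - a) ^+ 2)); last first.
    by rewrite /y /p /q; ring.
  apply: mulr_ge0; first by rewrite mulr_ge0 ?subr_ge0.
  (* Complete the square; (b - a)^2 = (p + q)^2 dominates ((q - p) / 2)^2. *)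
  rewrite [leRHS](_ : _ = (y + (q - p) / 2%:R) ^+ 2
             + (3%:R * (p + q) ^+ 2 + 4%:R * (p * q)) / 4%:R); last first.
    by rewrite /p /q; field.
  apply: addr_ge0; first exact: sqr_ge0.
  apply: divr_ge0 => //; apply: addr_ge0; apply: mulr_ge0 => //.
    exact: sqr_ge0.
  exact: le_trans m2_ge0 m2_le.
have : m2 ^+ 2 <= p * q * m2 by rewrite expr2 ler_wpM2r.
lra.
Qed.

Theorem theorem2p6 (R : rcfType) (n : nat) (x : 'I_n.+1 -> R)
    (hx : lepto_or_mesokurtic x) :
  let a := sample_min x in
  let b := sample_max x in
  variance x <= (b - a) * Num.sqrt ((mean x - a) * (b - mean x) / 6%:R) /\
  (b - a) * Num.sqrt ((mean x - a) * (b - mean x) / 6%:R)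
    <= (b - a) ^+ 2 / (2%:R * Num.sqrt 6%:R).
Proof.
move=> a b; case: hx => m2_gt0 kurt.
have xab i : a <= x i <= b by rewrite sample_min_le sample_max_ge.
have ab_ge0 : 0 <= b - a.
  by rewrite subr_ge0; have /andP[] := xab ord0; apply: le_trans.
have m4_ge : 3%:R * central_moment 2 x ^+ 2 <= central_moment 4 x.
  by rewrite -ler_pdivlMr // exprn_gt0.
have m4_le := central_moment4_le _ _ _ _ _ xab.
split.
  rewrite -[X in X * _](ger0_norm ab_ge0) -sqrtr_sqr -sqrtrM ?sqr_ge0 //.
  rewrite -[variance x](ger0_norm (ltW m2_gt0)) -sqrtr_sqr ler_wsqrtr // /variance.
  lra.
rewrite expr2 -[leRHS]mulrA; apply: ler_wpM2l => //.
rewrite invfM [leRHS]mulrA -(ger0_norm (divr_ge0 ab_ge0 (ler0n R 2))).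
rewrite -sqrtr_sqr -sqrtrV ?ler0n // -sqrtrM ?sqr_ge0 // ler_wsqrtr //.
rewrite ler_wpM2r ?invr_ge0 ?ler0n // -subr_ge0.
(* AM-GM for the gaps mean x - a and b - mean x, whose sum is b - a. *)
rewrite [leRHS](_ : _ = (mean x - (a + b) / 2%:R) ^+ 2) ?sqr_ge0 //.
by field.
Qed.
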